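(* Let $L$ be an algebra over $\mathbb{C}$ that is anticommutative ($xy=-yx$ for all $x,y\in L$) and antiassociative ($(xy)z=-x(yz)$ for all $x,y,z\in L$). Then $L$ is a $\left(-\tfrac12\right)$-Lie algebra, that is, $(xy)z=-\tfrac12\big((xz)y+x(yz)\big)$ for all $x,y,z\in L$.
   Context: An algebra means a complex vector space with a bilinear multiplication, not assumed associative. For $\delta\in\mathbb{C}$, a $\delta$-Lie algebra is an anticommutative algebra satisfying $(xy)z=\delta\big((xz)y+x(yz)\big)$ for all $x,y,z$. *)

(* Defs.v *)
From mathcomp Require Import all_boot all_order all_algebra.
From mathcomp Require Import reals.
From mathcomp.real_closed Require Import complex.

Set Implicit Arguments.
Unset Strict Implicit.
Unset Printing Implicit Defensive.

Import GRing.Theory Num.Theory.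
Local Open Scope ring_scope.
Local Open Scope complex_scope.

(* A complex algebra is an R[i]-module L, with R a model of the real numbers, *)
(* together with its multiplication mul : {bilinear L -> L -> L}, not assumed *)
(* to be associative or unital.                                               *)
Section ComplexAlgebra.

Variables (R : realType) (L : lmodType R[i]) (mul : {bilinear L -> L -> L}).

Definition anticommutative_alg : Prop :=
  forall x y : L, mul x y = - mul y x.

Definition antiassociative_alg : Prop :=
  forall x y z : L, mul (mul x y) z = - mul x (mul y z).

Definition delta_Lie (delta : R[i]) : Prop :=
  anticommutative_alg /\
  forall x y z : L,
    mul (mul x y) z = delta *: (mul (mul x z) y + mul x (mul y z)).

End ComplexAlgebra.

(* Main.v *)
Require Import Defs.
From mathcomp Require Import all_boot all_order all_algebra.
From mathcomp Require Import reals.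
From mathcomp.real_closed Require Import complex.

Import GRing.Theory Num.Theory.
Local Open Scope ring_scope.
Local Open Scope complex_scope.

Theorem lemma4 (R : realType) (L : lmodType R[i])
    (mul : {bilinear L -> L -> L})
    (anticomm : anticommutative_alg mul)
    (antiassoc : antiassociative_alg mul) :
  delta_Lie mul (- (1 / 2%:R)).
Proof.
split=> // x y z.
(* Moving the brackets of (xz)y and swapping the inner factors of x(zy) each
   cost a sign, so (xz)y = -x(zy) = x(yz); since also (xy)z = -x(yz), the
   claim reduces to the scalar identity -(1/2) * 2 = -1. *)
have xzy : mul (mul x z) y = mul x (mul y z).
  by rewrite antiassoc (anticomm z y) linearNr opprK.
rewrite xzy antiassoc -mulr2n -[mul _ _ *+ 2]scaler_nat.
by rewrite scalerA mulNr divfK ?pnatr_eq0 // scaleN1r.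
Qed.
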